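(* Let $G$ be a finite group and $L_N(G)=\{H\in L(G): H \text{ is nilpotent}\}$. If $S=(G\times G)\sqcup L_N(G)$, then \[ {\Pr}_{\mathrm{nil}}(G)=\frac{\sum_{H\in L_N(G)}\deg_{\mathcal{B}(G)[S]}(H)}{|G|^2}=\frac{|e(\mathcal{B}(G)[S])|}{|G|^2}. \]
   Context: For a group $G$, let $L(G)$ be the set of all subgroups of $G$. The graph $\mathcal{B}(G)$ is the simple undirected bipartite graph with vertex set the disjoint union $V(\mathcal{B}(G)) = (G\times G) \sqcup L(G)$, in which $(a,b)\in G\times G$ and $H \in L(G)$ are adjacent if and only if $H = \langle a,b\rangle$, and there are no other edges. For $S\subseteq V(\mathcal{B}(G))$, $\mathcal{B}(G)[S]$ is the subgraph of $\mathcal{B}(G)$ induced by $S$; $e(\Gamma)$ is the edge set of a graph $\Gamma$ and $\deg_\Gamma$ the degree in $\Gamma$. ${\Pr}_{\mathrm{nil}}(G)=\dfrac{|\{(a,b)\in G\times G: \langle a,b\rangle \text{ is nilpotent}\}|}{|G|^2}$ is the nilpotency degree of $G$. *)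

(* Defs.v *)
From HB Require Import structures.
From mathcomp Require Import all_boot all_order all_algebra all_fingroup all_solvable.
Set Implicit Arguments.
Unset Strict Implicit.
Unset Printing Implicit Defensive.
Import GRing.Theory Num.Theory.

Section SimpleGraph.
Variable T : finType.

(* The vertex set is a subset of T, so that a graph and its induced subgraphs
   live over the same type. *)
Record sgraph := SGraph {
  vset : {set T};
  adj : rel T;
  adj_vset : forall x y, adj x y -> (x \in vset) && (y \in vset);
  adj_sym : symmetric adj;
  adj_irr : irreflexive adj
}.

(* Edges are unordered pairs; each has exactly two elements by adj_irr. *)
Definition edges (X : sgraph) : {set {set T}} :=
  [set [set p.1; p.2] | p : T * T & adj X p.1 p.2].

Definition deg (X : sgraph) (x : T) : nat := #|[set y | adj X x y]|.

Section Induced.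
Variables (X : sgraph) (S : {set T}).

Definition induced_adj : rel T := [rel x y | [&& x \in S, y \in S & adj X x y]].

Fact induced_adj_vset x y :
  induced_adj x y -> (x \in vset X :&: S) && (y \in vset X :&: S).
Proof. by case/and3P=> xS yS /adj_vset /andP[xX yX]; rewrite !inE xX yX xS yS. Qed.

Fact induced_adj_sym : symmetric induced_adj.
Proof. by move=> x y; rewrite /induced_adj /= andbCA (@adj_sym X). Qed.

Fact induced_adj_irr : irreflexive induced_adj.
Proof. by move=> x; rewrite /induced_adj /= (@adj_irr X) !andbF. Qed.

Definition induced : sgraph :=
  SGraph induced_adj_vset induced_adj_sym induced_adj_irr.

End Induced.
End SimpleGraph.

Definition disj_union (T1 T2 : finType) (A : {set T1}) (B : {set T2}) :
    {set T1 + T2} :=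
  [set inl a | a in A] :|: [set inr b | b in B].

Section SubgroupGeneratingBipartiteGraph.
Variables (gT : finGroupType) (G : {group gT}).

(* Ambient type of the vertices: only Bvset, which is (G x G) + L(G), counts. *)
Definition Bvertex : finType := ((gT * gT) + {group gT})%type.

Definition Bvset : {set Bvertex} := disj_union (setX G G) (subgroups G).

Definition generates (p : gT * gT) (H : {group gT}) : bool :=
  H :==: <<[set p.1; p.2]>>%g.

Definition Badj : rel Bvertex := fun x y =>
  [&& x \in Bvset, y \in Bvset &
    match x, y with
    | inl p, inr H => generates p H
    | inr H, inl p => generates p H
    | _, _ => false
    end].

Fact Badj_vset x y : Badj x y -> (x \in Bvset) && (y \in Bvset).
Proof. by case/and3P=> -> ->. Qed.

Fact Badj_sym : symmetric Badj.
Proof. by move=> x y; rewrite /Badj andbCA; case: x y => [p|H] [q|K]. Qed.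

Fact Badj_irr : irreflexive Badj.
Proof. by move=> [p|H]; rewrite /Badj !andbF. Qed.

Definition Bgraph : sgraph Bvertex := SGraph Badj_vset Badj_sym Badj_irr.

Definition nil_subgroups : {set {group gT}} :=
  [set H in subgroups G | nilpotent H].

Definition Pr_nil : rat :=
  (#|[set p in setX G G | nilpotent <<[set p.1; p.2]>>%g]|%:R
     / #|G|%:R ^+ 2)%R.

End SubgroupGeneratingBipartiteGraph.

(* Main.v *)
(** Every pair [p] in G x G is adjacent in B(G) to exactly one subgroup,
    namely <p.1, p.2>, so the pairs generating a nilpotent subgroup are
    partitioned by the neighbourhoods of the nilpotent subgroups, and they
    correspond bijectively to the edges of the induced subgraph. *)
Require Import Defs.
From mathcomp Require Import all_boot all_order all_algebra all_fingroup all_solvable.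
Local Open Scope ring_scope.

Lemma inl_disj_union (T1 T2 : finType) (A : {set T1}) (B : {set T2}) (x : T1) :
  (inl x \in disj_union A B) = (x \in A).
Proof.
rewrite inE mem_imset; last by move=> ? ? [].
by rewrite orbC; case: imsetP => // -[].
Qed.

Lemma inr_disj_union (T1 T2 : finType) (A : {set T1}) (B : {set T2}) (y : T2) :
  (inr y \in disj_union A B) = (y \in B).
Proof.
rewrite inE (mem_imset _ y); last by move=> ? ? [].
by case: imsetP => // -[].
Qed.

Section NilpotentPairs.
Variables (gT : finGroupType) (G : {group gT}).

Definition pair_group (p : gT * gT) : {group gT} := <<[set p.1; p.2]>>%G.

Definition nil_pairs : {set gT * gT} :=
  [set p in setX G G | nilpotent (pair_group p)].

Definition nil_graph : sgraph (Bvertex gT) :=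
  induced (Bgraph G) (disj_union (setX G G) (nil_subgroups G)).

Lemma pair_group_nil_subgroups (p : gT * gT) :
  p \in nil_pairs -> pair_group p \in nil_subgroups G.
Proof.
case: p => a b; rewrite !inE /= => /andP[/andP[aG bG] ->].
by rewrite andbT gen_subG subUset !sub1set aG bG.
Qed.

(** The memberships in the vertex set and in [S] collapse into one condition on [p], since [H] is
    determined by [p]; all counts below rest on this form. *)
Lemma adj_nil_graph (p : gT * gT) (H : {group gT}) :
  adj nil_graph (inl p) (inr H) = (p \in nil_pairs) && (H == pair_group p).
Proof.
rewrite /= /induced_adj /= /Badj /Bvset !inl_disj_union !inr_disj_union.
(* Equality of groups computes to equality of their underlying sets. *)
have -> : generates p H = (H == pair_group p) by [].
have [->|_] := eqVneq H (pair_group p); last by rewrite !andbF.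
rewrite !andbT; apply/idP/idP.
  by case/and4P=> pG; rewrite !inE in pG *; case/andP=> _ ->; rewrite pG.
move=> pN; have HN := pair_group_nil_subgroups _ pN.
by rewrite HN; move: pN HN; rewrite !inE => /andP[-> _] /andP[-> _].
Qed.

Lemma adj_nil_graph_inl (p q : gT * gT) : adj nil_graph (inl p) (inl q) = false.
Proof. by rewrite /= /induced_adj /= /Badj !andbF. Qed.

Lemma adj_nil_graph_inr (H K : {group gT}) : adj nil_graph (inr H) (inr K) = false.
Proof. by rewrite /= /induced_adj /= /Badj !andbF. Qed.

(** By bipartiteness all neighbours of [H] lie on the [inl] side, and they are the injective image
    of the fibre of [pair_group] over [H]. *)
Lemma deg_nil_graph (H : {group gT}) :
  deg nil_graph (inr H) = #|[set p in nil_pairs | pair_group p == H]|.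
Proof.
have inl_injB : injective (inl : gT * gT -> Bvertex gT) by move=> ? ? [].
rewrite /deg -(card_imset _ inl_injB); congr #|pred_of_set _|; apply/setP => -[p|K].
  by rewrite inE adj_sym adj_nil_graph mem_imset // [RHS]inE eq_sym.
by rewrite inE adj_nil_graph_inr; apply/esym/imsetP => -[].
Qed.

Lemma sum_deg_nil_graph :
  (\sum_(H in nil_subgroups G) deg nil_graph (inr H))%N = #|nil_pairs|.
Proof.
rewrite -sum1_card (partition_big pair_group _ pair_group_nil_subgroups) /=.
apply: eq_bigr => H _; rewrite deg_nil_graph -sum1_card.
by apply: eq_bigl => p; rewrite inE.
Qed.

Lemma edges_nil_graph :
  edges nil_graph =
    [set [set inl p; inr (pair_group p)] | p in nil_pairs].
Proof.
apply/setP => e; apply/imsetP/imsetP => [[[x y]]|[p pN ->]]; last first.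
  exists (inl p, inr (pair_group p)) => //.
  by rewrite inE adj_nil_graph pN eqxx.
rewrite inE; case: x y => [p|H] [q|K]; rewrite [fst _]/= [snd _]/=.
- by rewrite adj_nil_graph_inl.
- by rewrite adj_nil_graph => /andP[pN /eqP ->] ->; exists p.
(* The reversed orientation yields the same unordered edge. *)
- by rewrite adj_sym adj_nil_graph => /andP[qN /eqP ->] ->; exists q; rewrite // setUC.
- by rewrite adj_nil_graph_inr.
Qed.

(** An edge determines its pair, which is its only [inl] element; hence testing equal edges at
    [inl p] gives injectivity. *)
Lemma card_edges_nil_graph : #|edges nil_graph| = #|nil_pairs|.
Proof.
rewrite edges_nil_graph card_imset // => p q /setP/(_ (inl p)).
by rewrite !inE eqxx /= orbF => /esym/eqP[].
Qed.

End NilpotentPairs.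

Theorem theorem3p6 (gT : finGroupType) (G : {group gT}) :
  let S : {set Bvertex gT} := disj_union (setX G G) (nil_subgroups G) in
  let BS := induced (Bgraph G) S in
  Pr_nil G
    = (\sum_(H in nil_subgroups G) deg BS (inr H))%N%:R / #|G|%:R ^+ 2
  /\ (\sum_(H in nil_subgroups G) deg BS (inr H))%N%:R / #|G|%:R ^+ 2
    = #|edges BS|%:R / #|G|%:R ^+ 2 :> rat.
Proof.
move=> S BS.
(* [BS] is convertible to [nil_graph G], and the numerator of [Pr_nil] to the cardinal of
   [nil_pairs], so all three fractions become the same. *)
by rewrite (sum_deg_nil_graph _ G) (card_edges_nil_graph _ G).
Qed.
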